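(* For every integer $n\ge 0$, $$C_{n+1}C_{n+2}=\sum_{k=0}^{n}\frac{(2k+2)(2k+3)(2k+4)}{(2n+2)(2n+3)(2n+6)(2n+7)}\binom{2n+3}{n-k}\binom{2n+7}{n-k+2}.$$
   Context: $C_n=\frac{1}{n+1}\binom{2n}{n}$ is the $n$-th Catalan number. *)

(* Defs.v *)
From mathcomp Require Import all_boot all_order all_algebra.

Set Implicit Arguments.
Unset Strict Implicit.
Unset Printing Implicit Defensive.

Import GRing.Theory.
Local Open Scope ring_scope.

(* Rational-valued, so that the division by n + 1 is exact by definition. *)
Definition catalan (n : nat) : rat := 1 / (n + 1)%:R * 'C(2 * n, n)%:R.

(* Main.v *)
(** The summand telescopes: Gosper's algorithm writes it as the difference of
    [antidiff n k] and [antidiff n k.+1], up to a factor independent of [k], so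
    that the sum is a multiple of [antidiff n 0]. *)
Require Import Defs.
From mathcomp Require Import all_boot all_order all_algebra.
From mathcomp Require Import ring lra zify.

Import GRing.Theory Num.Theory.
Local Open Scope ring_scope.

(* The binomials are the complements of [C(2n+2, n-k)] and [C(2n+6, n-k+2)]:
   this form avoids truncated subtraction and vanishes at [k = n + 1]. *)
Definition antidiff (n k : nat) : rat :=
  2 * ((n%:R + 1) * (n%:R + 3) + (2 * n%:R + 5) * (k%:R + 1) ^+ 2)
  / ((n%:R + 2) * (2 * n%:R + 5))
  * 'C(2 * n + 2, n + k + 2)%:R * 'C(2 * n + 6, n + k + 4)%:R.

(** Serves to reduce neighbouring binomials in a row to a single one, so that [field] can finish. At
    [j = m] both sides are 0. *)
Lemma natr_bin_succ (F : numFieldType) (m j : nat) : (j <= m)%N ->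
  'C(m, j.+1)%:R = (m%:R - j%:R) / (j%:R + 1) * 'C(m, j)%:R :> F.
Proof.
move=> le_jm; apply: (@mulfI F j.+1%:R); first by rewrite pnatr_eq0.
rewrite -natrM mul_bin_left natrM natrB // -natr1.
by field; rewrite natr1 pnatr_eq0.
Qed.

(** Symmetry, Pascal's rule and [natr_bin_succ] make every binomial a rational multiple of [a] or
    [b], the two binomials of [antidiff n k]; what remains is a rational identity in [n] and [k]. *)
Lemma summand_antidiff (n k : nat) : (k <= n)%N ->
  ((2 * k + 2) * (2 * k + 3) * (2 * k + 4))%:R
    / ((2 * n + 2) * (2 * n + 3) * (2 * n + 6) * (2 * n + 7))%:R
    * 'C(2 * n + 3, n - k)%:R * 'C(2 * n + 7, n - k + 2)%:R
  = ((2 * n + 2) * (2 * n + 6))%:R^-1 * (antidiff n k - antidiff n k.+1).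
Proof.
move=> le_kn; rewrite /antidiff.
have -> : 'C(2 * n + 3, n - k) = 'C((2 * n + 2).+1, (n + k + 2).+1).
  by rewrite -bin_sub; [congr 'C(_, _); lia | lia].
have -> : 'C(2 * n + 7, n - k + 2) = 'C((2 * n + 6).+1, (n + k + 4).+1).
  by rewrite -bin_sub; [congr 'C(_, _); lia | lia].
have -> : (n + k.+1 + 2 = (n + k + 2).+1)%N by lia.
have -> : (n + k.+1 + 4 = (n + k + 4).+1)%N by lia.
rewrite !binS !(natrD _ 'C(_, _)) !natr_bin_succ; [|lia..].
set a := 'C(_, _)%:R; set b := 'C(_, _)%:R.
rewrite !(natrM, natrD, mulrSr, mulr0n, add0r).
have n0 : 0 <= n%:R :> rat by exact: ler0n.
have k0 : 0 <= k%:R :> rat by exact: ler0n.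
by field; do ?[apply/andP; split]; lra.
Qed.

Lemma antidiff0 (n : nat) :
  antidiff n 0 = ((2 * n + 2) * (2 * n + 6))%:R * (catalan (n + 1) * catalan (n + 2)).
Proof.
rewrite /antidiff /catalan addn0.
have -> : 'C(2 * n + 2, n + 2) = 'C(2 * (n + 1), (n + 1).+1).
  by congr 'C(_, _); lia.
have -> : 'C(2 * n + 6, n + 4) = 'C((2 * (n + 2)).+2, (n + 2).+2).
  by congr 'C(_, _); lia.
(* Pascal's rule, applied twice, descends to row [2 * (n + 2)], whose central binomial occurs in
   [catalan (n + 2)]. *)
rewrite (binS _.+1) (binS _ (n + 2).+1) (binS _ (n + 2)) !natrD.
rewrite !natr_bin_succ; [|lia..].
set a := 'C(_, _)%:R; set b := 'C(_, _)%:R.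
rewrite !(natrM, natrD, mulrSr, mulr0n, add0r).
have n0 : 0 <= n%:R :> rat by exact: ler0n.
by field; do ?[apply/andP; split]; lra.
Qed.

Lemma antidiff_last (n : nat) : antidiff n n.+1 = 0.
Proof. by rewrite /antidiff (@bin_small (2 * n + 2)) ?mulr0 ?mul0r //; lia. Qed.

Theorem corollary3p12 (n : nat) :
  catalan (n + 1) * catalan (n + 2) =
  \sum_(0 <= k < n.+1)
    ((2 * k + 2) * (2 * k + 3) * (2 * k + 4))%:R
    / ((2 * n + 2) * (2 * n + 3) * (2 * n + 6) * (2 * n + 7))%:R
    * 'C(2 * n + 3, n - k)%:R * 'C(2 * n + 7, n - k + 2)%:R :> rat.
Proof.
set c : rat := ((2 * n + 2) * (2 * n + 6))%:R.
(* The minus sign is there because telescoping expects the summand as value at [k.+1] minus value at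
   [k]. *)
rewrite (@telescope_sumr_eq _ 0 n.+1 (fun k => - (c^-1 * antidiff n k))) //.
  rewrite antidiff_last mulr0 oppr0 sub0r opprK antidiff0 mulKf //.
  by rewrite pnatr_eq0; lia.
by move=> k /andP[_ lt_kn]; rewrite summand_antidiff // mulrBr opprK addrC.
Qed.
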